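(* Let $c$ be a real number and let $X$ be a metric space that has Nagata dimension zero with constant $c$. Then there exists a dense subset of $X$ that, equipped with the restricted metric, is $8c$-bilipschitz equivalent to a weighted tree. If $c=1$, then the factor $8$ is the best possible; that is, for every real number $K<8$ there exists a metric space which has Nagata dimension zero with constant $1$ and which has no dense subset that is $K$-bilipschitz equivalent to a weighted tree.
   Context: A metric space $X$ has \emph{Nagata dimension zero with constant} $c$ if for all real numbers $s>0$, $X$ admits a covering $\mathcal{B}_s$ (by subsets of $X$) with $\operatorname{diam}(B)\leq cs$ for every $B\in\mathcal{B}_s$ and $d(B,B')>s$ for all distinct $B,B'\in\mathcal{B}_s$, where $d(B,B')=\inf\{d(b,b'): b\in B,\ b'\in B'\}$. A map $f\colon X\to Y$ between metric spaces is $C$-\emph{bilipschitz}, for a constant $C\geq 0$, if there exists $s>0$ such that $s\,d(x,y)\leq d(f(x),f(y))\leq Cs\,d(x,y)$ for all $x,y\in X$. Two metric spaces are $C$-\emph{bilipschitz equivalent} if there exists a bijective $C$-bilipschitz map between them. Trees are connected acyclic simple graphs, with possibly infinite vertex set. A \emph{weighted tree} is a metric space $(V,d)$ obtained from a tree $T=(V,E)$ and a weight function $\omega\colon E\to(0,\infty)$ by letting $d$ be the shortest-path metric on the vertex set: $d(x,x')=\sum_{i=0}^{n-1}\omega(\{x_i,x_{i+1}\})$, where $(x_0,\dots,x_n)$ is the unique path without repeated vertices in $T$ from $x$ to $x'$ (and $d(x,x)=0$). *)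

(* Defs.v *)
From HB Require Import structures.
From mathcomp Require Import all_boot all_order all_algebra.
From mathcomp Require Import boolp classical_sets reals constructive_ereal ereal.
From mathcomp Require Import topology.

Set Implicit Arguments.
Unset Strict Implicit.
Unset Printing Implicit Defensive.

Import Order.TTheory GRing.Theory Num.Theory.

Local Open Scope classical_set_scope.
Local Open Scope ring_scope.

(* The subset A of X with the restricted metric.  This is a separate name
   because the bare set_type A already carries the initial topology. *)
Definition metric_subspace (R : realType) (X : metricType R) (A : set X) : Type :=
  set_type A.

Section MetricSubspace.
Context (R : realType) (X : metricType R) (A : set X).

HB.instance Definition _ := Choice.copy (metric_subspace A) (set_type A).

Let sub_dist (x y : metric_subspace A) : R := mdist (\val x) (\val y).

Let sub_distxx x : sub_dist x x = 0.
Proof. exact: mdistxx. Qed.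

Let sub_dist_positivity x y : sub_dist x y = 0 -> x = y.
Proof. by move=> /mdist_positivity /val_inj. Qed.

Let sub_dist_sym x y : sub_dist x y = sub_dist y x.
Proof. exact: metric_sym. Qed.

Let sub_dist_triangle y x z : sub_dist x z <= sub_dist x y + sub_dist y z.
Proof. exact: metric_triangle. Qed.

HB.instance Definition _ := isMetric.Build R (metric_subspace A)
  sub_distxx sub_dist_positivity sub_dist_sym sub_dist_triangle.

End MetricSubspace.

Lemma mdist_subspaceE (R : realType) (X : metricType R) (A : set X)
  (x y : metric_subspace A) : mdist x y = mdist (\val x) (\val y).
Proof. by []. Qed.

(* Both are extended reals: an unbounded set has diameter +oo, and the distance
   to the empty set is +oo. *)
Definition diam (R : realType) (X : metricType R) (B : set X) : \bar R :=
  ereal_sup [set (mdist b b')%:E | b in B & b' in B].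

Definition set_dist (R : realType) (X : metricType R) (B B' : set X) : \bar R :=
  ereal_inf [set (mdist b b')%:E | b in B & b' in B'].

Definition nagata_dim_zero (R : realType) (c : R) (X : metricType R) : Prop :=
  forall s : R, 0 < s ->
  exists Bs : set (set X),
    [/\ \bigcup_(B in Bs) B = setT,
        forall B, Bs B -> (diam B <= (c * s)%:E)%E
      & forall B B', Bs B -> Bs B' -> B <> B' -> (s%:E < set_dist B B')%E].

(* C is not required to be nonnegative.  This matters only for spaces with at
   most one point: as soon as X has two points, the inequalities force 1 <= C. *)
Definition bilipschitz (R : realType) (C : R) (X Y : metricType R)
    (f : X -> Y) : Prop :=
  exists s : R, 0 < s /\
    forall x y : X, s * mdist x y <= mdist (f x) (f y) <= C * s * mdist x y.

Definition bilipschitz_equivalent (R : realType) (C : R) (X Y : metricType R) :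
    Prop :=
  exists f : X -> Y, bijective f /\ bilipschitz C f.

Definition connected_graph (V : eqType) (e : rel V) : Prop :=
  forall x y : V, exists p : seq V, path e x p /\ last x p = y.

Definition acyclic_graph (V : eqType) (e : rel V) : Prop :=
  forall p : seq V, ucycle e p -> (size p < 3)%N.

(* The graph without vertices counts as a tree. *)
Definition is_tree (V : eqType) (e : rel V) : Prop :=
  [/\ symmetric e, irreflexive e, connected_graph e & acyclic_graph e].

(* The length of the path x :: p.  Edges are unordered pairs [set a; b]; the
   values of w on other sets are irrelevant. *)
Definition path_length (R : realType) (V : Type) (w : set V -> R)
    (x : V) (p : seq V) : R :=
  \sum_(l <- pairmap (fun a b => w [set a; b]) x p) l.

Definition is_weighted_tree (R : realType) (V : metricType R) : Prop :=
  exists (e : rel V) (w : set V -> R),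
    [/\ is_tree e,
        forall x y, e x y -> 0 < w [set x; y]
      & forall (x : V) (p : seq V), path e x p -> uniq (x :: p) ->
          mdist x (last x p) = path_length w x p].

(* Main.v *)
(* Upper bound.  In a space of Nagata dimension zero with constant c, the classes
   of the relation "joined by a chain of steps of length at most 2^i" have
   diameter at most c 2^i, and the resulting partitions are nested as i runs
   through the integers.  A well-order on X picks the least point of every class
   as its representative, so the representative of a class also represents the
   smaller class containing it; the representatives form a dense set D.  Join a
   representative of an i-class that does not represent its (i+1)-class to the
   representative of the latter by an edge of length 2^(i+1).  If x and y are
   separated at level j but not at level j+1, the path from x to y contains an
   edge of length 2^(j+1) and, for each i <= j, at most two edges of length
   2^(i+1); so its length is between 2^(j+1) and 8 2^j, whereas d(x,y) is between
   2^j and c 2^(j+1).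

   Lower bound.  Take words of length n over 9 letters, at distance q^l if l is
   the last position (counted from 1) at which they differ, with q slightly above
   1.  Root the tree.  If the root path of x leaves the l-ball of x at cost E(l)
   and lands at distance q^F(l) from x, then E(F(l)) >= E(l) + q^F(F(l)).  Having
   E(l) < k q^l at all levels for some k < 4 would give A_{i+2} <= k (A_{i+1} - A_i)
   for A_i = E(F^i(1)), which is impossible over many levels (the lower bound of
   the online bidding problem).  So every x is costly at some level, and
   descending into balls one finds a level l and nine l-balls in a common
   (l+1)-ball that all contain a costly point.  If two of their root paths stay
   apart until they have left their l-balls, these points are at tree distance at
   least 2 k q^l, which is almost 8 q^(l+1).  Otherwise all root paths run one
   into another, and then one of them contains 8 edges of length q^(l+1) between
   two points at distance q^(l+1). *)
Require Import Defs.
From HB Require Import structures.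
From mathcomp Require Import all_boot all_order all_algebra.
From mathcomp Require Import boolp classical_sets reals constructive_ereal ereal.
From mathcomp Require Import topology zify lra.
From mathcomp Require wochoice.

Set Implicit Arguments.
Unset Strict Implicit.
Unset Printing Implicit Defensive.

Import Order.TTheory GRing.Theory Num.Theory.

Local Open Scope classical_set_scope.
Local Open Scope ring_scope.

(** * Weighted trees on nested partitions *)

Definition is_distance (R : realType) (V : Type) (dist : V -> V -> R) :=
  [/\ forall x, dist x x = 0, forall x y, dist x y = 0 -> x = y,
      forall x y, dist x y = dist y x
    & forall y x z, dist x z <= dist x y + dist y z].

Definition metrized (R : realType) (V : Type) (dist : V -> V -> R)
  (h : is_distance dist) : Type := V.

Section Metrized.
Context (R : realType) (V : choiceType) (dist : V -> V -> R).
Variable h : is_distance dist.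

HB.instance Definition _ := Choice.copy (metrized h) V.

Let dist_xx (x : metrized h) : dist x x = 0.
Proof. by have [] : is_distance dist by []. Qed.

Let dist_positivity (x y : metrized h) : dist x y = 0 -> x = y.
Proof. by have [_ pos _ _] : is_distance dist by []; exact: pos. Qed.

Let dist_sym (x y : metrized h) : dist x y = dist y x.
Proof. by have [] : is_distance dist by []. Qed.

Let dist_triangle (y x z : metrized h) : dist x z <= dist x y + dist y z.
Proof. by have [] : is_distance dist by []. Qed.

HB.instance Definition _ := isMetric.Build R (metrized h)
  dist_xx dist_positivity dist_sym dist_triangle.

End Metrized.

(** Every edge gets the distance of its ends as weight; additivity then splits a simple path edge by
    edge. *)
Lemma weighted_tree_of_additive (R : realType) (T : metricType R) (e : rel T) :
  is_tree e ->
  (forall x y p, path e x (y :: p) -> uniq (x :: y :: p) ->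
    mdist x (last y p) = mdist x y + mdist y (last y p)) ->
  is_weighted_tree T.
Proof.
move=> te add.
(* Weights live on unordered pairs; by symmetry of the metric the value does not depend on the order
   of [a] and [b]. *)
pose P (S : set T) (r : R) := exists a b, S = [set a; b] /\ r = mdist a b.
pose w (S : set T) := xget 0 (P S).
have wE a b : w [set a; b] = mdist a b.
  rewrite /w; case: xgetP => [r _ [a' [b' [ab ->]]]|/(_ (mdist a b))].
    have [aa bb] : [set a'; b'] a /\ [set a'; b'] b.
      by rewrite -ab; split; [left|right].
    have [aa' bb'] : [set a; b] a' /\ [set a; b] b'.
      by rewrite ab; split; [left|right].
    case: aa => /= aa; case: bb => /= bb; case: aa' => /= aa'; case: bb' => /= bb';
      subst => //; exact: metric_sym.
  by case; exists a, b.
exists e, w; split=> [//|x y exy|x p].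
  rewrite wE mdist_gt0; case: te => _ irr _ _.
  by apply/eqP => xy; rewrite xy irr in exy.
rewrite /path_length; elim: p x => [|y p IH] x /=.
  by rewrite big_nil mdistxx.
move=> /andP[xy yp] /andP[xyp up].
by rewrite big_cons wE -IH//; apply: add; rewrite /= ?xy ?yp ?xyp.
Qed.

Section SumOverIntegers.
Context {R : realType}.
Implicit Types (F G : int -> R) (N : nat).

(** The sum over [-N <= i < N], since [Negz k] is [-(k+1)]. *)
Definition zsum N F : R := \sum_(k < N) (F (Posz k) + F (Negz k)).

Lemma zsumS N F : zsum N.+1 F = zsum N F + (F (Posz N) + F (Negz N)).
Proof. exact: big_ord_recr. Qed.

Lemma zsumD N F G : zsum N (fun i => F i + G i) = zsum N F + zsum N G.
Proof. by rewrite -big_split; apply: eq_bigr => k _; rewrite addrACA. Qed.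

Lemma eq_zsum N F G : F =1 G -> zsum N F = zsum N G.
Proof. by move=> FG; apply: eq_bigr => k _; rewrite !FG. Qed.

Lemma ler_zsum N F G : (forall i, F i <= G i) -> zsum N F <= zsum N G.
Proof. by move=> FG; apply: ler_sum => k _; rewrite lerD. Qed.

Lemma zsum_widen N M F : (N <= M)%N ->
  (forall i : int, (N <= `|i|)%N -> F i = 0) -> zsum M F = zsum N F.
Proof.
move=> /subnKC <- F0; elim: (M - N)%N => [|k IH]; first by rewrite addn0.
rewrite addnS zsumS IH !F0 ?addr0//; lia.
Qed.

Lemma zsum_ge_term N F j : (forall i, 0 <= F i) -> (`|j| < N)%N ->
  F j <= zsum N F.
Proof.
move=> F0 jN; have kN : ((if j is Negz k then k else `|j|) < N)%N.
  by case: j jN => k /=; lia.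
rewrite /zsum (bigD1 (Ordinal kN))//= -[leLHS]addr0 lerD//.
  by case: j {jN kN} => k /=; rewrite ?absz_nat ?lerDl ?lerDr.
by apply: sumr_ge0 => k _; rewrite addr_ge0.
Qed.

Lemma zsum_telescope N F :
  zsum N (fun i => F (i + 1) - F i) = F N%:Z - F (- N%:Z).
Proof.
elim: N => [|N IH]; first by rewrite /zsum big_ord0 oppr0 subrr.
rewrite zsumS IH.
have -> : Posz N + 1 = N.+1 by lia.
have -> : Negz N = - N.+1%:Z by lia.
have -> : - N.+1%:Z + 1 = - N%:Z by lia.
lra.
Qed.

End SumOverIntegers.

Lemma exp2zS (R : realType) (i : int) : (2 : R) ^ (i + 1) = 2 ^ i * 2.
Proof. by rewrite expfzDr ?pnatr_eq0. Qed.

(** * The tree of class representatives and its path metric *)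

Section AncestralTree.
Context {R : realType} (V : choiceType).
Variables (E : int -> V -> V -> Prop) (m : int -> V -> V).
Hypothesis Esym : forall i x y, E i x y -> E i y x.
Hypothesis Etrans : forall i y x z, E i x y -> E i y z -> E i x z.
Hypothesis Emono : forall i k x y, i <= k -> E i x y -> E k x y.
Hypothesis Ecof : forall x y, exists i, E i x y.
Hypothesis Esep : forall x y, x <> y -> exists j, ~ E j x y /\ E (j + 1) x y.
Hypothesis mE : forall i x, E i x (m i x).
Hypothesis m_eq : forall i x y, E i x y -> m i x = m i y.
Hypothesis m_coh : forall i k x, i <= k -> E i x (m k x) -> m i x = m k x.
Hypothesis m_fix : forall x, exists i, m i x = x.
Hypothesis m_cst : forall x, exists N, forall i, N <= i -> m i x = m N x.

Let Erefl i x : E i x x.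
Proof. exact: Etrans (mE i x) (Esym (mE i x)). Qed.

Let m_stay i k x : i <= k -> m k x = x -> m i x = x.
Proof. by move=> ik kx; rewrite (m_coh ik) kx. Qed.

Definition jump x i : R := if m i x == m (i + 1) x then 0 else 2 ^ (i + 1).

(** The path from [x] to [y] climbs from both ends until their classes merge, so exactly the jumps
    at separated levels count. *)
Definition sep_term x y i : R :=
  if `[< E i x y >] then 0 else jump x i + jump y i.

Let jump_ge0 x i : 0 <= jump x i.
Proof. by rewrite /jump; case: ifP => // _; rewrite exprz_ge0. Qed.

Let jump_le x i : jump x i <= 2 ^ (i + 1).
Proof. by rewrite /jump; case: ifP => // _; rewrite exprz_ge0. Qed.

Let jump_eq i k x y : E i x y -> i <= k -> jump x k = jump y k.
Proof.
by move=> xy ik; rewrite /jump (m_eq (Emono ik xy)) (@m_eq (k + 1) x y)//;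
  apply: Emono xy; lia.
Qed.

Let jump_low i k x : m k x = x -> i < k -> jump x i = 0.
Proof.
move=> kx ik; rewrite /jump (@m_stay i k)// ?(ltW ik)// (@m_stay (i + 1) k)//.
  by rewrite eqxx.
lia.
Qed.

(** By coherence there is no jump below a level at which [x] represents its own class; there is none
    once the representatives have become constant. *)
Let jump_supp x : exists N : nat, forall i : int, (N <= `|i|)%N -> jump x i = 0.
Proof.
have [a ax] := m_fix x; have [b bx] := m_cst x.
exists (`|a| + `|b| + 1)%N => i iN.
have [ia|ia] := ltP i a; first exact: jump_low ax ia.
by rewrite /jump !bx ?eqxx//; lia.
Qed.

Definition supp_bound := projT1 (choice jump_supp).

Definition tree_dist x y :=
  zsum (maxn (supp_bound x) (supp_bound y)) (sep_term x y).

Let sep_term_ge0 x y i : 0 <= sep_term x y i.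
Proof. by rewrite /sep_term; case: ifP => // _; rewrite addr_ge0. Qed.

Let tree_distE N x y : (supp_bound x <= N)%N -> (supp_bound y <= N)%N ->
  tree_dist x y = zsum N (sep_term x y).
Proof.
move=> xN yN; symmetry; apply: zsum_widen; first by rewrite geq_max xN yN.
move=> i; rewrite geq_max => /andP[ix iy]; rewrite /sep_term.
have jb z : (supp_bound z <= `|i|)%N -> jump z i = 0.
  by rewrite /supp_bound; case: (choice _) => f /= hf; apply: hf.
by rewrite !jb// addr0; case: ifP.
Qed.

Let tree_dist_upper j x y : E (j + 1) x y -> tree_dist x y <= 2 ^ (j + 3).
Proof.
(* For [i <= j], two jumps of at most [2^(i+1)] give [2^(i+2) = G (i+1) - G i]; the truncation at
   [j+1] makes the differences vanish where [x] and [y] share a class. *)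
move=> xy; set G : int -> R := fun i => 2 ^ (Num.min i (j + 1) + 2).
apply: (@le_trans _ _ (zsum (maxn (supp_bound x) (supp_bound y))
    (fun i => G (i + 1) - G i))).
  apply: ler_zsum => i; rewrite /sep_term /G.
  have [ij|ij] := leP i j.
    have -> : Num.min i (j + 1) = i by lia.
    have -> : Num.min (i + 1) (j + 1) = i + 1 by lia.
    have -> : (2 : R) ^ (i + 1 + 2) = 2 ^ (i + 2) * 2.
      by rewrite -[in RHS]exp2zS; congr (_ ^ _); lia.
    have E2 : (2 : R) ^ (i + 2) = 2 ^ (i + 1) * 2.
      by rewrite -exp2zS; congr (_ ^ _); lia.
    have := jump_le x i; have := jump_le y i; have := jump_ge0 x i.
    have := jump_ge0 y i.
    by case: ifP => _; lra.
  have -> : Num.min i (j + 1) = j + 1 by lia.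
  have -> : Num.min (i + 1) (j + 1) = j + 1 by lia.
  rewrite subrr asboolT//; apply: Emono xy; lia.
rewrite zsum_telescope.
have : 0 <= G (- (maxn (supp_bound x) (supp_bound y))%:Z) by exact: exprz_ge0.
suff : G (maxn (supp_bound x) (supp_bound y)) <= 2 ^ (j + 3) by lra.
by rewrite /G ler_eXz2l ?ltr1n//; lia.
Qed.

(** The representatives differ at level [j] and agree at level [j+1], so at least one of the two
    points jumps. *)
Let tree_dist_lower j x y :
  ~ E j x y -> E (j + 1) x y -> 2 ^ (j + 1) <= tree_dist x y.
Proof.
move=> nxy xy; set N := maxn `|j|.+1 (maxn (supp_bound x) (supp_bound y)).
rewrite (@tree_distE N); [|lia|lia].
apply: le_trans (@zsum_ge_term _ N _ j (sep_term_ge0 x y) _); last by lia.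
rewrite /sep_term asboolF// /jump -(m_eq xy).
have p0 : 0 <= (2 : R) ^ (j + 1) by rewrite exprz_ge0.
case: eqP => [xx|_]; last by case: ifP => _; lra.
case: eqP => [yy|_]; last by lra.
case: nxy; apply: Etrans (mE j x) _; rewrite xx -yy; exact: Esym.
Qed.

Let tree_distxx x : tree_dist x x = 0.
Proof.
by rewrite /tree_dist /zsum big1// => k _; rewrite /sep_term !asboolT ?addr0.
Qed.

Let tree_dist_positivity x y : tree_dist x y = 0 -> x = y.
Proof.
move=> d0; apply: contrapT => /Esep[j [nxy xy]].
have := tree_dist_lower nxy xy; rewrite d0 leNgt exprz_gt0//.
Qed.

Let sep_term_sym x y i : sep_term x y i = sep_term y x i.
Proof.
rewrite /sep_term addrC; congr (if _ then _ else _).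
by apply: asbool_equiv_eq; split=> /Esym.
Qed.

Let tree_dist_sym x y : tree_dist x y = tree_dist y x.
Proof. by rewrite /tree_dist maxnC; apply: eq_zsum => i; exact: sep_term_sym. Qed.

(** If [x] and [z] are separated, [y] is separated from one of them; if it shares the class of the
    other, it also shares its jump. *)
Let sep_term_triangle y x z i : sep_term x z i <= sep_term x y i + sep_term y z i.
Proof.
have := jump_ge0 y i; have := jump_ge0 x i; have := jump_ge0 z i; rewrite /sep_term.
case: asboolP => [_ |xz]; first by case: ifP => _; case: ifP => _; lra.
case: asboolP => [xy|xy]; case: asboolP => [yz|yz]; try lra.
- by case: xz; exact: Etrans xy yz.
- by rewrite (jump_eq xy (lexx i)); lra.
- by rewrite (jump_eq yz (lexx i)); lra.
Qed.

Let zsum_split3 x y z N : (supp_bound x <= N)%N -> (supp_bound y <= N)%N ->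
  (supp_bound z <= N)%N ->
  tree_dist x y + tree_dist y z = zsum N (fun i => sep_term x y i + sep_term y z i).
Proof. by move=> xN yN zN; rewrite !(@tree_distE N)// zsumD. Qed.

Let tree_dist_triangle y x z : tree_dist x z <= tree_dist x y + tree_dist y z.
Proof.
pose N := maxn (supp_bound x) (maxn (supp_bound y) (supp_bound z)).
rewrite (@zsum_split3 _ _ _ N); [|lia..].
by rewrite (@tree_distE N); [|lia..]; apply: ler_zsum => i; exact: sep_term_triangle.
Qed.

Definition parent_at i u v := [/\ m i u = u, m (i + 1) u = v & u <> v].

Definition tree_edge : rel V := fun u v =>
  `[< exists i, parent_at i u v \/ parent_at i v u >].

Let parentE i u v : parent_at i u v ->
  [/\ E (i + 1) u v, ~ E i u v & forall k, k <= i + 1 -> m k v = v].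
Proof.
move=> [iu <- uv]; have vv k : k <= i + 1 -> m k (m (i + 1) u) = m (i + 1) u.
  by move=> ki; apply: m_stay ki _; rewrite -(m_eq (mE (i + 1) u)).
split=> // /m_eq; rewrite iu => e; apply: uv; rewrite {1}e; apply: vv; lia.
Qed.

Let parent_low i u v k : parent_at i u v -> k < i -> jump u k = 0.
Proof. by move=> [iu _ _]; apply: jump_low. Qed.

Let parent_low' i u v k : parent_at i u v -> k <= i -> jump v k = 0.
Proof.
move=> /parentE[_ _ vv] ki; apply: (@jump_low k (i + 1)); last by lia.
exact: vv.
Qed.

Let tree_edgeP a b : tree_edge a b ->
  exists i c d, parent_at i c d /\ (c = a /\ d = b \/ c = b /\ d = a).
Proof. by move=> /asboolP[i [H|H]]; exists i; do 2 eexists; split; eauto. Qed.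

(* The only edge leaving the class of [u] is the edge between [u] and its parent. *)
Let edge_in_class i u v a b : parent_at i u v -> tree_edge a b ->
  [\/ a <> u /\ b <> u | a <> v /\ b <> v] -> E i u a -> E i u b.
Proof.
move=> uv /tree_edgeP[k [c [d [cd H]]]] avoid.
have {avoid}cdE : ~ (c = u /\ d = v).
  by move=> [cu dv]; case: H => [[? ?]|[? ?]]; subst; case: avoid => -[].
suff : E i u c <-> E i u d by move=> [h1 h2]; case: H => [[<- <-]|[<- <-]].
case: (uv) (cd) => iu iv nuv [kc kd ncd]; have [Ecd _ dd] := parentE cd.
have [ki|ki] := ltP k i.
  have {}Ecd : E i c d by apply: Emono Ecd; lia.
  by split=> [h|h]; apply: Etrans h _; [|exact: Esym].
(* For [k >= i], an end in the class of [u] must be [u] itself. This gives the excluded edge or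
   makes [u] represent its [(i+1)]-class, which [v] does. *)
split=> [h|h]; exfalso.
  have cu : c = u by rewrite -(m_stay ki kc) -(m_eq h).
  subst c; apply: cdE; split=> //; case: ltgtP ki => // [ik|ik] _; last first.
    by rewrite -iv -kd ik.
  by case: nuv; rewrite -iv; symmetry; apply: (m_stay _ kc); lia.
have du : d = u by rewrite -iu (m_eq h) dd//; lia.
by apply: nuv; rewrite -iv -du dd//; lia.
Qed.

(** A path that misses [u] or [v] cannot use the edge between them, the only way in or out of the
    class. *)
Let path_in_class i u v a p : parent_at i u v -> path tree_edge a p ->
  (u \notin a :: p) || (v \notin a :: p) -> E i u a <-> E i u (last a p).
Proof.
move=> uv; elim: p a => [//|b p IH] a /= /andP[ab bp] avoid.
have avoid2 : [\/ a <> u /\ b <> u | a <> v /\ b <> v].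
  by move: avoid; rewrite !inE => /orP[h|h]; [left|right]; split=> e; subst;
    move: h; rewrite eqxx ?orbT.
have ba : tree_edge b a.
  by move/asboolP: ab => [k [h|h]]; apply/asboolP; exists k; [right|left].
rewrite -IH//; last first.
  by move: avoid; rewrite !inE !negb_or => /orP[/andP[_ ->]|/andP[_ ->]]; rewrite ?orbT.
split; apply: edge_in_class uv _ _ => //.
by case: avoid2 => -[? ?]; [left|right].
Qed.

Let tree_edge_irr : irreflexive tree_edge.
Proof. by move=> x; apply/asboolP => -[i [|] [_ _]]. Qed.

Let tree_edge_sym : symmetric tree_edge.
Proof.
by move=> x y; apply: asbool_equiv_eq; split=> -[i h]; exists i; rewrite orC.
Qed.

Let tree_dist_additive x y p : path tree_edge x (y :: p) -> uniq (x :: y :: p) ->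
  tree_dist x (last y p) = tree_dist x y + tree_dist y (last y p).
Proof.
move=> /= /andP[xy yp] /andP[xyp uyp]; set z := last y p.
pose N := maxn (supp_bound x) (maxn (supp_bound y) (supp_bound z)).
rewrite (@zsum_split3 _ _ _ N); [|lia..].
rewrite (@tree_distE N); [|lia..]; apply: eq_zsum => k.
move: xy => /asboolP[i [uv|uv]]; have [Euv nEuv _] := parentE uv.
(* Climbing edge: the path never returns to [x], so [z] is outside the [i]-class of [x], and the
   parent [y] has no jumps up to level [i]. *)
- have nz : ~ E i x z by move=> /(path_in_class uv yp _).2; rewrite xyp => /(_ isT).
  have [ik|ik] := ltP i k.
    have Ek : E k x y by apply: Emono Euv; lia.
    rewrite /sep_term (asboolT Ek) add0r (jump_eq Ek (lexx k)).
    congr (if _ then _ else _); apply: asbool_equiv_eq.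
    by split=> h; [exact: Etrans (Esym Ek) h|exact: Etrans Ek h].
  have nk a b : ~ E i a b -> ~ E k a b by move=> h /(Emono ik).
  rewrite /sep_term (asboolF (nk _ _ nEuv)) (asboolF (nk _ _ nz)).
  rewrite (parent_low' uv ik) addr0; case: asboolP => [yz|_]; last by rewrite add0r.
  by rewrite -(jump_eq yz (lexx k)) (parent_low' uv ik).
(* Descending edge: [z] stays in the [i]-class of [y]. As [y] has no jumps below [i] and [x] none up
   to [i], the edge counts at level [i] only. *)
- have zy : E i y z.
    by apply/(path_in_class uv yp); [rewrite xyp orbT|exact: Erefl].
  have nz : ~ E i x z by move=> h; apply: nEuv; apply: Etrans zy (Esym h).
  have [ik|ik] := ltP i k.
    have Ek : E k x y by apply: Emono (Esym Euv); lia.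
    rewrite /sep_term (asboolT Ek) add0r (jump_eq Ek (lexx k)).
    congr (if _ then _ else _); apply: asbool_equiv_eq.
    by split=> h; [exact: Etrans (Esym Ek) h|exact: Etrans Ek h].
  have nk a b : ~ E i a b -> ~ E k a b by move=> h /(Emono ik).
  have nEvu : ~ E i x y by move=> /Esym.
  rewrite /sep_term (asboolF (nk _ _ nEvu)) (asboolF (nk _ _ nz)).
  rewrite (parent_low' uv ik) !add0r.
  move: ik; rewrite le_eqVlt => /orP[/eqP->|ik].
    by rewrite (asboolT zy) addr0 (jump_eq zy (lexx i)).
  rewrite (parent_low uv ik) !add0r; case: asboolP => // yz.
  by rewrite -(jump_eq yz (lexx k)) (parent_low uv ik).
Qed.

(** The rest of a cycle would join the ends of its first edge without using it, hence inside one
    [i]-class, which that edge leaves. *)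
Let tree_acyclic : acyclic_graph tree_edge.
Proof.
move=> p /andP[]; case: p => [//|x [//|y [//|y' p']]]; set p := y' :: p'.
rewrite (cycle_path x) /= => /and3P[zx xy yp] /and3P[xyp ynp up].
exfalso; set z := last y' p' in zx.
have zy : z <> y by move=> e; move: ynp; rewrite -e mem_last.
have xz : x <> z.
  by move=> e; move: xyp; rewrite e !inE -in_cons mem_last !orbT.
have xy' : x <> y by move=> e; move: xyp; rewrite e !inE eqxx.
have yP : path tree_edge y p by [].
have zE : last y p = z by [].
move: xy => /asboolP[i [uv|uv]]; have [_ nE _] := parentE uv.
- apply: nE; apply/(path_in_class uv yP); first by rewrite xyp.
  rewrite zE; apply: (edge_in_class uv (a := x) (b := z)); 
    [by rewrite tree_edge_sym| |exact: Erefl].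
  by right; split.
- apply: nE; apply: (edge_in_class uv zx); first by left; split.
  by rewrite -zE; apply/(path_in_class uv yP); rewrite ?xyp ?orbT//; exact: Erefl.
Qed.

Let tree_conn_up i n x : exists p,
  path tree_edge (m i x) p /\ last (m i x) p = m (i + Posz n) x.
Proof.
elim: n => [|n [p [pp lp]]]; first by exists [::]; rewrite addr0.
have -> : i + n.+1 = i + n + 1 by lia.
have [e|/eqP ne] := eqVneq (m (i + n) x) (m (i + n + 1) x).
  by exists p; rewrite -e.
exists (rcons p (m (i + n + 1) x)); rewrite last_rcons rcons_path pp lp; split=> //.
apply/asboolP; exists (i + n); left; split=> //.
  by rewrite -(m_eq (mE _ _)).
by rewrite -(@m_eq _ x)//; apply: Emono (mE (i + n) x); lia.
Qed.

Let tree_connected : connected_graph tree_edge.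
Proof.
move=> x y; have [a ax] := m_fix x; have [b by_] := m_fix y.
have [k xy] := Ecof x y; pose c := Num.max k (Num.max a b).
have [p [pp lp]] := tree_conn_up a `|c - a| x.
have [q [qp lq]] := tree_conn_up b `|c - b| y.
have ca : a + `|c - a|%N = c by lia.
have cb : b + `|c - b|%N = c by lia.
rewrite ax ca in pp lp; rewrite by_ cb in qp lq.
have ec : m c x = m c y by apply: m_eq; apply: Emono xy; lia.
exists (p ++ rev (belast y q)); rewrite cat_path last_cat pp lp ec -lq rev_path; split.
  by rewrite (eq_path (e' := tree_edge))// => u v; exact: tree_edge_sym.
by case: (q) => //= ? ?; rewrite rev_cons last_rcons.
Qed.

Lemma ancestral_tree : exists T : metricType R, is_weighted_tree T /\
  exists phi : V -> T, bijective phi /\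
    forall j x y, ~ E j x y -> E (j + 1) x y ->
      2 ^ (j + 1) <= mdist (phi x) (phi y) <= 2 ^ (j + 3).
Proof.
have dd : is_distance tree_dist by split.
exists (metrized dd : metricType R); split; last first.
  exists id; split; first by exists id.
  by move=> j x y nxy xy; rewrite [mdist _ _]/(tree_dist _ _)
    tree_dist_lower// tree_dist_upper.
apply: (@weighted_tree_of_additive _ _ (tree_edge : rel (metrized dd))).
  by split.
exact: tree_dist_additive.
Qed.

End AncestralTree.

(** * Representatives and chains *)

Lemma coherent_representatives (X : eqType) (E : int -> X -> X -> Prop) :
  (forall i x, E i x x) ->
  (forall i x y, E i x y -> E i y x) ->
  (forall i y x z, E i x y -> E i y z -> E i x z) ->
  (forall i k x y, i <= k -> E i x y -> E k x y) ->
  (forall x y, exists i, E i x y) ->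
  exists m : int -> X -> X,
    [/\ forall i x, E i x (m i x),
        forall i x y, E i x y -> m i x = m i y,
        forall i k x, i <= k -> E i x (m k x) -> m i x = m k x
      & forall x, exists N, forall i, N <= i -> m i x = m N x].
Proof.
move=> Erefl Esym Etrans Emono Ecof.
have [le le_wo] := wochoice.well_ordering_principle X.
have anti : antisymmetric le.
  by have := wochoice.wo_chain_antisymmetric (wochoice.withinW (A := predT) le_wo);
    move=> h x y; exact: h.
have ex_min (P : X -> Prop) : (exists x, P x) ->
    exists z, P z /\ forall y, P y -> le z y.
  move=> [x Px]; have [|z [[Pz zP] _]] := le_wo [pred y | `[< P y >]].
    by exists x; apply/asboolP.
  exists z; split; first exact/asboolP.
  by move=> y Py; apply: zP; apply/asboolP.
have /choice[m mP] (ix : int * X) :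
    exists z, E ix.1 ix.2 z /\ forall y, E ix.1 ix.2 y -> le z y.
  by apply: ex_min; exists ix.2.
pose M i x := m (i, x); exists M.
have ME i x : E i x (M i x) by have [] := mP (i, x).
have Mle i x y : E i x y -> le (M i x) y by have [_] := mP (i, x); apply.
split=> // [i x y xy|i k x ik xk|x].
- apply: anti; rewrite !Mle//; last exact: Etrans xy (ME i y).
  exact: Etrans (Esym _ _ _ xy) (ME i x).
- by apply: anti; rewrite !Mle//; exact: Emono (ME i x).
(* As soon as the class of [x] contains the least point [x0] of the whole space, [x0] represents it
   at all higher levels. *)
- have [|x0 [_ x0P]] := ex_min (fun=> True); first by exists x.
  have [N xN] := Ecof x x0; exists N => i Ni.
  have Mx0 k : N <= k -> M k x = x0.
    by move=> Nk; apply: anti; rewrite x0P// Mle//; exact: Emono xN.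
  by rewrite !Mx0.
Qed.

Section Chains.
Context {R : realType} {X : metricType R}.
Implicit Types (s : R) (x y z : X).

(* [x] and [y] are joined by a chain of steps of length at most [s]: [y] belongs
   to every set that contains [x] and is closed under such steps. *)
Definition chained s x y := forall A : set X,
  (forall a b, A a -> mdist a b <= s -> A b) -> A x -> A y.

Lemma chained_refl s x : chained s x x. Proof. by []. Qed.

Lemma chained_sym s x y : chained s x y -> chained s y x.
Proof.
move=> xy A Acl Ay; apply: contrapT => nAx; apply: (xy (~` A)) => //.
by move=> a b nAa ab Ab; apply: nAa; apply: Acl Ab _; rewrite metric_sym.
Qed.

Lemma chained_trans s y x z : chained s x y -> chained s y z -> chained s x z.
Proof. by move=> xy yz A Acl Ax; apply: yz => //; exact: xy. Qed.

Lemma chained_mono s t x y : s <= t -> chained s x y -> chained t x y.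
Proof.
move=> st xy A Acl; apply: xy => a b Aa ab; apply: Acl Aa _.
exact: le_trans ab st.
Qed.

Lemma chained_step s x y : mdist x y <= s -> chained s x y.
Proof. by move=> xy A Acl Ax; exact: Acl xy. Qed.

(** Distinct members of the covering are more than [s] apart, so a chain never leaves the member it
    starts in. *)
Lemma chained_dist c s x y : nagata_dim_zero c X -> 0 < s ->
  chained s x y -> mdist x y <= c * s.
Proof.
move=> nX s0 xy; have [Bs [cov small far]] := nX _ s0.
have [B BsB Bx] : (\bigcup_(B in Bs) B) x by rewrite cov.
have By : B y.
  apply: xy Bx => a b Ba ab.
  have [B' BsB' B'b] : (\bigcup_(B in Bs) B) b by rewrite cov.
  suff -> : B = B' by [].
  apply: contrapT => /(far _ _ BsB BsB'); apply/negP; rewrite -leNgt.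
  apply: (@le_trans _ _ (mdist a b)%:E); last by rewrite lee_fin.
  by apply: ereal_inf_lbound; exists a => //; exists b.
rewrite -lee_fin; apply: le_trans (small _ BsB).
by apply: ereal_sup_ubound; exists x => //; exists y.
Qed.

End Chains.

Lemma exp2z_gt (R : realType) (r : R) : exists n : nat, r < 2 ^ n%:Z.
Proof.
exists (Num.truncn r).+1; rewrite -exprnP -natrX.
have [r0|r0] := leP 0 r; last by apply: lt_le_trans r0 _.
by apply: lt_le_trans (truncnS_gt r) _; rewrite ler_nat ltnW// ltn_expl.
Qed.

Lemma exp2z_lt (R : realType) (r : R) : 0 < r -> exists n : nat, 2 ^ (- n%:Z) < r.
Proof.
move=> r0; have [n rn] := exp2z_gt r^-1; exists n.
by rewrite -invr_expz -[r]invrK ltf_pV2// posrE ?invr_gt0// exprz_gt0.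
Qed.

Lemma nagata_weighted_tree (R : realType) (c : R) (X : metricType R) :
  nagata_dim_zero c X ->
  exists D : set X, dense D /\
    exists T : metricType R, is_weighted_tree T /\
      bilipschitz_equivalent (8 * c) (metric_subspace D) T.
Proof.
move=> nX; pose E (i : int) (x y : X) := chained (2 ^ i) x y.
have p2 i : 0 < (2 : R) ^ i by rewrite exprz_gt0.
have Emono i k x y : i <= k -> E i x y -> E k x y.
  by move=> ik; apply: chained_mono; rewrite ler_eXz2l ?ltr1n.
have Ecof x y : exists i, E i x y.
  by have [n /ltW/chained_step] := exp2z_gt (mdist x y); exists n.
have Edist i x y : E i x y -> mdist x y <= c * 2 ^ i by exact: chained_dist.
have Esmall r : 0 < r -> exists i, c * 2 ^ i < r.
  move=> r0; have [c0|c0] := leP c 0.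
    by exists 0; rewrite mulr1 (le_lt_trans c0).
  have [n] := exp2z_lt (divr_gt0 r0 c0); rewrite ltr_pdivlMr// mulrC.
  by exists (- n%:Z).
have Esep x y : x <> y -> exists j, ~ E j x y /\ E (j + 1) x y.
  move=> /eqP; rewrite -mdist_gt0 => /Esmall[a ca].
  have na : ~ E a x y by move=> /Edist; rewrite leNgt ca.
  have [b xy] := Ecof x y.
  (* The least level from [a] on that joins [x] and [y] is not [a] itself, so the level before it
     still separates them. *)
  pose P n := `[< E (a + Posz n) x y >].
  have exP : exists n, P n.
    by exists `|b - a|%N; apply/asboolP; apply: Emono xy; lia.
  case: (ex_minnP exP) => -[|n] /asboolP En minn; first by rewrite addr0 in En.
  exists (a + n%:Z); split; last by have -> : a + n%:Z + 1 = a + n.+1%:Z by lia.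
  by move=> /asboolP/minn; rewrite ltnn.
have [m [mE m_eq m_coh m_cst]] := coherent_representatives
  (fun i x => @chained_refl _ _ (2 ^ i) x) (fun i => @chained_sym _ _ (2 ^ i))
  (fun i => @chained_trans _ _ (2 ^ i)) Emono Ecof.
pose D : set X := [set x | exists i, m i x = x].
have mm i x : m i (m i x) = m i x by rewrite -(m_eq _ _ _ (mE i x)).
have mD i x : m i x \in D by rewrite inE; exists i.
exists D; split.
  move=> O [x Ox] oO.
  have : nbhs x O by apply: open_nbhs_nbhs.
  rewrite -nbhs_ballE => -[r /= /Esmall[i ir] rO]; exists (m i x).
  split; last by exists i.
  by apply: rO; rewrite ballEmdist /=; apply: le_lt_trans ir; exact: Edist (mE i x).
pose V : metricType R := metric_subspace D.
pose m' i (x : V) : V := SigSub (mD i (\val x)).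
have m'_eq i (x y : V) : E i (\val x) (\val y) -> m' i x = m' i y.
  by move=> xy; apply: val_inj; exact: m_eq.
have m'_coh i k (x : V) : i <= k -> E i (\val x) (\val (m' k x)) -> m' i x = m' k x.
  by move=> ik xk; apply: val_inj; exact: m_coh.
have m'_fix (x : V) : exists i, m' i x = x.
  have /set_mem[i ix] := valP x.
  by exists i; apply: val_inj.
have m'_cst (x : V) : exists N, forall i, N <= i -> m' i x = m' N x.
  have [N xN] := m_cst (\val x); exists N => i Ni.
  by apply: val_inj; exact: xN.
have EVsep (x y : V) : x <> y ->
    exists j, ~ E j (\val x) (\val y) /\ E (j + 1) (\val x) (\val y).
  by move=> xy; apply: Esep => /val_inj.
have [T [wT [phi [bphi phiE]]]] := @ancestral_tree R V
  (fun i x y => E i (\val x) (\val y)) m'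
  (fun i x y => @chained_sym _ _ _ _ _) (fun i y x z => @chained_trans _ _ _ _ _ _)
  (fun i k x y => Emono i k _ _) (fun x y => Ecof _ _) EVsep
  (fun i x => mE i _) m'_eq m'_coh m'_fix m'_cst.
exists T; split=> //; exists phi; split=> //.
(* For [c <= 0] all distances vanish and any scale works. *)
have [c0|c0] := leP c 0.
  exists 1; split=> // x y.
  have -> : x = y.
    apply: mdist_positivity; apply/eqP; rewrite eq_le mdist_ge0 andbT.
    have [i xy] := Ecof (\val x) (\val y).
    by apply: le_trans (Edist _ _ _ xy) _; rewrite mulr_le0_ge0// ltW.
  by rewrite !mdistxx !mulr0 lexx.
(* The inequalities [d(x,y) <= c 2^(j+1)] and [2^(j+3) <= 8 d(x,y)] give the factors [1/c] and 8,
   whose ratio is [8c]. *)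
exists c^-1; split=> [|x y]; first by rewrite invr_gt0.
have [->|/eqP xy] := eqVneq x y; first by rewrite !mdistxx !mulr0 lexx.
have [j [nxy xyj]] := EVsep x y xy; have /andP[lo up] := phiE j x y nxy xyj.
have dlo : 2 ^ j <= mdist x y.
  by rewrite leNgt; apply/negP => /ltW xyj'; apply: nxy; exact: chained_step.
have dup : mdist x y <= c * 2 ^ (j + 1) := Edist _ _ _ xyj.
apply/andP; split; first by rewrite mulrC ler_pdivrMr// mulrC; nra.
rewrite mulfK ?gt_eqF//; apply: le_trans up _.
have -> : j + 3 = j + 1 + 1 + 1 by lia.
by rewrite !exp2zS; lra.
Qed.

(** * Optimality of the factor 8 *)

(* Since [s^2 - k s + k >= k - k^2 / 4], the map [s |-> k (1 - 1 / s)] lowers [s]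
   by at least [1 - k / 4] as long as [s <= k]. *)
Lemma bidding_step (R : realFieldType) (k s a b c : R) :
  0 < k -> k <= 4 -> 0 < s -> s <= k -> 0 <= b -> b <= s * a -> c <= k * (b - a) ->
  c <= (s - (1 - k / 4)) * b.
Proof.
move=> k0 k4 s0 sk b0 bsa cab.
have quad : k * (s - 1) <= s * (s - (1 - k / 4)).
  have : 0 <= (s - k / 2) * (s - k / 2) by rewrite -expr2 sqr_ge0.
  have : 0 <= (k - s) * (1 - k / 4) by rewrite mulr_ge0 ?subr_ge0//; lra.
  lra.
rewrite -(ler_pM2l s0).
have sc : s * c <= s * (k * (b - a)) by rewrite ler_pM2l.
have kb : k * b <= k * (s * a) by rewrite ler_pM2l.
have : k * (s - 1) * b <= s * (s - (1 - k / 4)) * b by rewrite ler_wpM2r.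
lra.
Qed.

(** The bound on the ratio of consecutive terms starts at [k] and drops by [h] in each step; after
    more than [k / h] steps it is negative. *)
Lemma bidding (R : realType) (k : R) : 0 < k -> k < 4 -> exists N : nat,
  forall A : nat -> R, (forall i, (i <= N.+2)%N -> 0 < A i) ->
    ~ forall i, (i <= N)%N -> A i.+2 <= k * (A i.+1 - A i).
Proof.
move=> k0 k4; pose h := 1 - k / 4.
have h0 : 0 < h by rewrite /h; lra.
pose N := (Num.truncn (k / h)).+1.
have Nh : k < N%:R * h by rewrite -ltr_pdivrMr// truncnS_gt.
exists N => A A0 rec.
have ratio i : (i <= N)%N -> A i.+2 <= (k - i%:R * h) * A i.+1.
  elim: i => [|i IH] iN.
    rewrite mul0r subr0; apply: le_trans (rec _ iN) _.
    by rewrite ler_pM2l// lerBlDr lerDl ltW// A0.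
  have {IH} := IH (ltnW iN); set s := k - i%:R * h => IH.
  have a2 : 0 < A i.+2 by apply: A0; lia.
  have a1 : 0 < A i.+1 by apply: A0; lia.
  have s0 : 0 < s by rewrite -(pmulr_lgt0 _ a1); apply: lt_le_trans IH.
  have sk : s <= k.
    by have : 0 <= i%:R * h by [rewrite mulr_ge0// ltW]; rewrite /s; lra.
  have -> : k - i.+1%:R * h = s - (1 - k / 4) by rewrite /s /h -natr1; lra.
  exact: (bidding_step k0 (ltW k4) s0 sk (ltW a2) IH (rec _ iN)).
have := ratio N (leqnn N); apply/negP; rewrite -ltNge.
apply: le_lt_trans (A0 N.+2 (leqnn _)).
by rewrite nmulr_rle0 ?ltW ?A0//; lra.
Qed.

(** Otherwise the offsets from the minimum, in units of [g], have only [n] possible integer parts;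
    two of the [n+1] numbers share one and are less than [g] apart. *)
Lemma separated_spread (R : realType) (n : nat) (h : 'I_n.+1 -> R) (g : R) :
  0 < g -> (forall c c', c != c' -> g <= `|h c - h c'|) ->
  exists c c', n%:R * g <= `|h c - h c'|.
Proof.
move=> g0 sep; apply: contrapT => small.
have {}small c c' : `|h c - h c'| < n%:R * g.
  by rewrite ltNge; apply/negP => ?; apply: small; exists c, c'.
pose c0 := [arg min_(c < ord0) h c]%O.
have c0min c : h c0 <= h c by rewrite /c0; case: arg_minP => // i _; apply.
pose t c := (h c - h c0) / g.
have t0 c : 0 <= t c by rewrite divr_ge0 ?subr_ge0// ltW.
have tn c : (Num.truncn (t c) < n)%N.
  rewrite truncn_lt_nat// ltr_pdivrMr//.
  by apply: le_lt_trans (small c c0); rewrite ler_norm.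
have : injective (fun c => Ordinal (tn c)).
  move=> c c' [tt]; apply/eqP; apply: contraT => /sep.
  have b x : (Num.truncn (t x))%:R <= t x < (Num.truncn (t x)).+1%:R.
    exact: truncn_itv.
  have -> : h c - h c' = (t c - t c') * g.
    by rewrite -mulrBl opprB addrA subrK divfK ?gt_eqF.
  rewrite normrM (gtr0_norm g0).
  rewrite -[leLHS]mul1r ler_pM2r// leNgt => /negP; case.
  have := b c; have := b c'; rewrite tt -natr1 => /andP[? ?] /andP[? ?].
  by rewrite ltr_norml; apply/andP; split; lra.
by move=> /leq_card; rewrite !card_ord ltnn.
Qed.

(** * Root paths in a weighted tree *)

Lemma belast_traject (V : Type) (f : V -> V) x k :
  belast x (traject f (f x) k) = traject f x k.
Proof. by elim: k x => //= k IH x; rewrite IH. Qed.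

(** Here [f] is the parent map for the root [r], with [f r = r]. The path between two vertices
    passes through the point where their root paths first meet. *)
Lemma weighted_tree_rooted (R : realType) (T : metricType R) (r : T) :
  is_weighted_tree T ->
  exists f : T -> T, [/\ forall x, exists k, iter k f x = r,
    forall x, mdist x r = mdist x (f x) + mdist (f x) r
  & forall x y, exists k l, iter k f x = iter l f y /\
      mdist x y = mdist x (iter k f x) + mdist (iter k f x) y].
Proof.
move=> [e [w [[esym _ econ _] _ dE]]].
have split_dist x p q : path e x (p ++ q) -> uniq (x :: p ++ q) ->
    mdist x (last x (p ++ q)) = mdist x (last x p) + mdist (last x p) (last x (p ++ q)).
  move=> pq u; rewrite dE//.
  move: pq; rewrite cat_path => /andP[xp lq].
  have u1 : uniq (x :: p) by move: u; rewrite -cat_cons cat_uniq => /andP[].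
  have u2 : uniq (last x p :: q).
    by move: u; rewrite -cat_cons lastI cat_rcons cat_uniq => /and3P[].
  rewrite (dE _ _ xp u1) last_cat (dE _ _ lq u2).
  by rewrite /path_length pairmap_cat big_cat.
have /choice[N NP] x : exists n, (exists p, [/\ path e x p, last x p = r & size p = n])
    /\ forall p, path e x p -> last x p = r -> (n <= size p)%N.
  pose P n := `[< exists p, [/\ path e x p, last x p = r & size p = n] >].
  have exP : exists n, P n.
    by have [p [xp pr]] := econ x r; exists (size p); apply/asboolP; exists p.
  case: (ex_minnP exP) => n /asboolP Pn nmin; exists n; split=> // p xp pr.
  by apply: nmin; apply/asboolP; exists p.
have N0 x : N x = 0%N -> x = r.
  move=> Nx; have [[p [_ pr pN]] _] := NP x.
  by move: pN pr; rewrite Nx => /eqP; rewrite size_eq0 => /eqP ->.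
have Nr : N r = 0%N by apply/eqP; rewrite -leqn0; apply: ((NP r).2 [::]).
have /choice[f fP] x : exists y, if x == r then y = r else
    [/\ e x y, N x = (N y).+1 & mdist x r = mdist x y + mdist y r].
  have [_|xr] := eqVneq x r; first by exists r.
  have [[p [xp pr pN]] Nmin] := NP x.
  move: pr; case/shortenP: xp => p' xp' up' sub pr.
  have sp' : (size p' <= N x)%N.
    by rewrite -pN; apply: uniq_leq_size sub; case/andP: up'.
  case: p' => [|y p'] in xp' up' sub pr sp' *; first by rewrite -pr eqxx in xr.
  exists y; split.
  - by case/andP: xp'.
  - apply/eqP; rewrite eqn_leq; apply/andP; split.
      have [[q [yq qr <-]] _] := NP y.
      by apply: (Nmin (y :: q)) => //=; rewrite yq andbT; case/andP: xp'.
    apply: leq_trans sp'; rewrite ltnS; apply: (NP y).2 => //.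
    by case/andP: xp'.
  - by have := split_dist x [:: y] p' xp' up'; rewrite /= in pr *; rewrite pr.
have fr : f r = r by have := fP r; rewrite eqxx.
have iter_r k : iter k f r = r by elim: k => //= k ->.
have NS x : N (f x) = (N x).-1.
  by have := fP x; case: eqP => [->|_ [_ ->]]; rewrite ?fr ?Nr.
have Niter k x : N (iter k f x) = (N x - k)%N.
  by elim: k => [|k IH]; rewrite ?subn0//= NS IH subnS.
have reach x : iter (N x) f x = r by apply: N0; rewrite Niter subnn.
exists f; split; first by move=> x; exists (N x).
  move=> x; have := fP x; case: eqP => [->|_ []//].
  by rewrite fr mdistxx addr0.
move=> x y.
(* Choosing [k] least, and then [l] least, makes the ascent from [x] followed by the descent to [y]
   free of repetitions. *)
pose P k := `[< exists l, iter k f x = iter l f y >].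
have exP : exists k, P k.
  by exists (N x); apply/asboolP; exists (N y); rewrite !reach.
case: (ex_minnP exP) => k /asboolP xy_meet kmin.
pose Q l := iter k f x == iter l f y.
have exQ : exists l, Q l by have [l] := xy_meet; exists l; apply/eqP.
case: (ex_minnP exQ) => l /eqP kl lmin; exists k, l; split=> //.
have xi i : (i < k)%N -> iter i f x <> r.
  move=> ik xr; suff /kmin : P i by rewrite leqNgt ik.
  by apply/asboolP; exists (N y); rewrite reach.
have yj j : (j < l)%N -> iter j f y <> r.
  move=> jl yr; suff /lmin : Q j by rewrite leqNgt jl.
  by rewrite /Q kl -(subnK (ltnW jl)) iterD yr iter_r.
have path_up z a : (forall i, (i < a)%N -> iter i f z <> r) ->
    path e z (traject f (f z) a).
  elim: a z => //= a IH z za; apply/andP; split.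
    by have := fP z; case: eqP => [zr|_ []//]; by case: (za 0%N).
  by apply: IH => i ia; rewrite -iterSr; apply: za.
have uniq_up z a : (forall i, (i < a)%N -> iter i f z <> r) ->
    uniq (traject f z a.+1).
  move=> za; rewrite looping_uniq; apply/negP => /trajectP[i ia zz].
  apply: (za i ia); apply: N0; rewrite Niter; have := congr1 N zz; rewrite !Niter; lia.
set p := traject f (f x) k; set q := rev (traject f y l).
have lp : last x p = iter k f x by rewrite last_traject.
have lq : last (iter k f x) q = y.
  rewrite /q; case: (l) kl => [|l'] -> //=.
  by rewrite rev_cons last_rcons.
have xpq : path e x (p ++ q).
  rewrite cat_path path_up//= lp kl /q -[X in rev X]belast_traject -last_traject.
  by rewrite rev_path (eq_path (e' := e)) ?path_up// => u v; exact: esym.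
have upq : uniq (x :: p ++ q).
  rewrite -cat_cons cat_uniq -/(traject f x k.+1) uniq_up//= rev_uniq.
  have := uniq_up y l yj; rewrite trajectSr rcons_uniq => /andP[_ ->]; rewrite andbT.
  apply/hasPn => a; rewrite mem_rev => /trajectP[j jl ->].
  suff : iter j f y \notin traject f x k.+1 by [].
  apply/negP => /trajectP[i ik yx].
  move: ik; rewrite ltnS leq_eqVlt => /orP[/eqP ik|ik].
    by have /lmin : Q j by [rewrite /Q yx ik]; rewrite leqNgt jl.
  have /kmin : P i by apply/asboolP; exists j.
  by rewrite leqNgt ik.
by have := split_dist x p q xpq upq; rewrite last_cat lp lq.
Qed.

(** * The cost of leaving balls along root paths *)

Section SpanningTreeBound.
Context {R : realType} (W : Type).
Variables (lev : W -> W -> nat) (n : nat).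
Hypothesis lev_xx : forall x, lev x x = 0%N.
Hypothesis lev_sym : forall x y, lev x y = lev y x.
Hypothesis lev_tri : forall y x z, (lev x z <= maxn (lev x y) (lev y z))%N.
Hypothesis lev_le : forall x y, (lev x y <= n)%N.
Hypothesis lev_child : forall x l, (l < n)%N -> exists f : 'I_9 -> W,
  (forall c, lev x (f c) <= l.+1)%N /\
  forall c c' y y', c != c' -> (lev (f c) y <= l)%N -> (lev (f c') y' <= l)%N ->
    lev y y' = l.+1.
Variables (q K k : R) (d : W -> W -> R) (f : W -> W) (r : W).
Hypothesis q1 : 1 < q.
Hypothesis k0 : 0 < k.
Hypothesis K8 : K < 8.
Hypothesis Kqk : K * q < 2 * k.
Hypothesis d_lo : forall x y, (0 < lev x y)%N -> q ^+ lev x y <= d x y.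
Hypothesis d_up : forall x y, (0 < lev x y)%N -> d x y <= K * q ^+ lev x y.
Hypothesis d_ge0 : forall x y, 0 <= d x y.
Hypothesis d_sym : forall x y, d x y = d y x.
Hypothesis d_tri : forall y x z, d x z <= d x y + d y z.
Hypothesis reach : forall x, exists i, iter i f x = r.
Hypothesis d_root : forall x, d x r = d x (f x) + d (f x) r.
Hypothesis meet : forall x y, exists i j, iter i f x = iter j f y /\
  d x y = d x (iter i f x) + d (iter i f x) y.

Let q0 : 0 < q. Proof. by apply: lt_trans q1. Qed.

Let H x := d x r.

Let H_iter x i : H (iter i f x) <= H x.
Proof.
elim: i => //= i IH; apply: le_trans IH; rewrite {2}/H d_root.
by rewrite /H lerDr d_ge0.
Qed.

Let H_iterW x i j : (i <= j)%N -> H (iter j f x) <= H (iter i f x).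
Proof. by move=> /subnK <-; rewrite iterD H_iter. Qed.

Definition exits x l i :=
  (l < lev x (iter i f x))%N /\ forall j, (j < i)%N -> (lev x (iter j f x) <= l)%N.

Let exitsE x l : (l < lev x r)%N -> exists i, exits x l i.
Proof.
move=> lr; have exP : exists i, (l < lev x (iter i f x))%N.
  by have [i xi] := reach x; exists i; rewrite xi.
case: (ex_minnP exP) => i li imin; exists i; split=> // j ji.
by rewrite leqNgt; apply/negP => /imin; rewrite leqNgt ji.
Qed.

Let exits_gt0 x l i : exits x l i -> (0 < i)%N.
Proof. by move=> [+ _]; case: i => //=; rewrite lev_xx. Qed.

(** The exit edge starts inside the [l]-ball, so by the ultrametric inequality its level equals that
    of the landing point seen from [x]. *)
Let exit_edge x l i : exits x l i ->
  H (iter i f x) + q ^+ lev x (iter i f x) <= H (iter i.-1 f x).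
Proof.
move=> xi; have i0 := exits_gt0 xi; case: xi => li before.
set u := iter i.-1 f x.
have fu : f u = iter i f x by rewrite /u -iterS prednK.
have ul : (lev x u <= l)%N by apply: before; rewrite prednK.
have e : lev u (f u) = lev x (iter i f x).
  rewrite fu; apply/eqP; rewrite eqn_leq.
  have := lev_tri x u (iter i f x); have := lev_tri u x (iter i f x).
  rewrite (lev_sym u x); lia.
rewrite -e -fu {2}/H (d_root u) addrC lerD2r d_lo// e.
exact: leq_ltn_trans li.
Qed.

Definition costly x l := exists i, exits x l i /\ k * q ^+ l <= H x - H (iter i f x).

Let not_all_costly l (y : 'I_9 -> W) :
  (forall c c', c != c' -> lev (y c) (y c') = l.+1) ->
  ~ forall c, costly (y c) l.
Proof.
move=> yl /choice[i iP].
have ex c : exits (y c) l (i c) by have [] := iP c.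
have cost c : k * q ^+ l <= H (y c) - H (iter (i c) f (y c)) by have [] := iP c.
(* The last vertex of each root path before it first leaves its [l]-ball. *)
pose u c := iter (i c).-1 f (y c).
have uin c : (lev (y c) (u c) <= l)%N.
  by apply: (ex c).2; rewrite prednK// (exits_gt0 (ex c)).
have ul c c' : c != c' -> lev (y c) (u c') = l.+1.
  move=> cc; have := yl _ _ cc; have := uin c'.
  have := lev_tri (u c') (y c) (y c'); have := lev_tri (y c') (y c) (u c').
  by rewrite (lev_sym (u c') (y c')); lia.
have uu c c' : c != c' -> lev (u c) (u c') = l.+1.
  move=> cc; have := ul _ _ cc; have := uin c.
  have := lev_tri (u c) (y c) (u c'); have := lev_tri (y c) (u c) (u c').
  by rewrite (lev_sym (u c) (y c)); lia.
have step c : H (iter (i c) f (y c)) + q ^+ l.+1 <= H (u c).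
  apply: le_trans (exit_edge (ex c)); rewrite lerD2l ler_eXn2l//.
  by have [] := ex c.
(* If the path of [y c] meets that of [y c'] before leaving its ball, then [u c] lies on the path of
   [y c'] past the exit edge, whose length is at least [q^(l+1)]. *)
have through c c' a b : c != c' -> (a < i c)%N ->
    iter a f (y c) = iter b f (y c') -> H (u c) + q ^+ l.+1 <= H (u c').
  move=> cc ai ab.
  have uE : u c = iter ((i c).-1 - a + b) f (y c').
    by rewrite iterD -ab -iterD subnK// -ltnS prednK// (leq_ltn_trans _ ai).
  have jb : (i c' <= (i c).-1 - a + b)%N.
    rewrite leqNgt; apply/negP => /((ex c').2); rewrite -uE ul 1?eq_sym//.
    by rewrite ltnn.
  by apply: le_trans (step c'); rewrite lerD2r uE H_iterW.
have sep c c' : c != c' -> q ^+ l.+1 <= `|H (u c) - H (u c')|.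
  move=> cc; have [a [b [ab dab]]] := meet (y c) (y c').
  have [ai|ai] := ltnP a (i c).
    have le := through _ _ _ _ cc ai ab.
    by rewrite distrC; apply: le_trans (ler_norm _); lra.
  have [bi|bi] := ltnP b (i c').
    have := through c' c b a; rewrite eq_sym => /(_ cc bi (esym ab)) le.
    by apply: le_trans (ler_norm _); lra.
  (* Both paths have left their balls before meeting at [z], so the distance is at least
     [2 k q^l > K q^(l+1)]. *)
  exfalso; set z := iter a f (y c) in ab dab.
  have yy : lev (y c) (y c') = l.+1 := yl _ _ cc.
  have : d (y c) (y c') <= K * q ^+ l.+1 by rewrite -yy d_up// yy.
  have := cost c; have := cost c'.
  have := H_iterW (y c) ai; have := H_iterW (y c') bi; rewrite -ab -/z.
  have : H (y c) <= d (y c) z + H z by exact: d_tri.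
  have : H (y c') <= d z (y c') + H z by rewrite (d_sym z); exact: d_tri.
  rewrite dab exprS.
  have : K * q * q ^+ l < 2 * k * q ^+ l by rewrite ltr_pM2r// exprn_gt0.
  lra.
(* Nine heights pairwise [q^(l+1)] apart spread over [8 q^(l+1)], and a height difference is at most
   a distance. *)
have [c [c' spread]] := separated_spread (exprn_gt0 l.+1 q0) sep.
have cc : c != c'.
  apply: contraTneq spread => ->; rewrite subrr normr0 -ltNge.
  by rewrite mulr_gt0// exprn_gt0.
have dK : d (u c) (u c') <= K * q ^+ l.+1 by rewrite -(uu _ _ cc) d_up// uu.
have Hd : `|H (u c) - H (u c')| <= d (u c) (u c').
  have : H (u c) <= d (u c) (u c') + H (u c') by exact: d_tri.
  have : H (u c') <= d (u c) (u c') + H (u c) by rewrite (d_sym (u c)); exact: d_tri.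
  move=> h1 h2.
  by rewrite ler_norml; apply/andP; split; lra.
have : K * q ^+ l.+1 < 8 * q ^+ l.+1 by rewrite ltr_pM2r// exprn_gt0.
lra.
Qed.

(** Descent from level [n]: of the nine [l]-balls in the current [(l+1)]-ball, [not_all_costly]
    leaves one without points costly at level [l]. *)
Let ex_cheap l : (0 < l < n)%N -> exists x, lev x r = n /\
  forall y j, (lev x y <= l)%N -> (l <= j)%N -> (j.+1 < n)%N -> ~ costly y j.
Proof.
suff main e : (0 < e < n)%N -> exists x, lev x r = n /\
    forall y j, (lev x y <= n - e)%N -> (n - e <= j)%N -> (j.+1 < n)%N -> ~ costly y j.
  move=> ln; have le_ln : (l <= n)%N by lia.
  by have := main (n - l)%N; rewrite (subKn le_ln); apply; lia.
(* For [e = 1] no [j] qualifies; of two points at mutual level [n], one has level [n] from [r]. *)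
elim: e {l} => // -[_ n1|e IH en].
  have [|g [_ gl]] := lev_child r (l := n.-1); first lia.
  have g01 := gl ord0 ord_max (g ord0) (g ord_max) isT; rewrite !lev_xx in g01.
  have /(_ isT isT) {}g01 := g01; rewrite prednK in g01; last lia.
  have [x xr] : exists x, lev x r = n.
    have := lev_tri r (g ord0) (g ord_max); rewrite g01 (lev_sym r).
    have := lev_le (g ord0) r; have := lev_le (g ord_max) r.
    case: (leqP n (lev (g ord0) r)) => [n1' ? ? ?|? ? ? ?].
      by exists (g ord0); lia.
    by exists (g ord_max); lia.
  by exists x; split=> // y j _; lia.
have [|x [xr xP]] := IH; first lia.
set l := (n - e.+2)%N; have lE : (n - e.+1)%N = l.+1 by rewrite /l; lia.
rewrite lE in xP.
have [|g [xg gl]] := lev_child x (l := l); first by rewrite /l; lia.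
apply: contrapT => no.
have bad c : exists y, (lev (g c) y <= l)%N /\ costly y l.
  apply: contrapT => good; apply: no; exists (g c); split.
    have := lev_tri (g c) x r; have := lev_le (g c) r; have := xg c.
    by rewrite xr /l; lia.
  move=> y j yl; rewrite leq_eqVlt => /orP[/eqP <- _ cy|lj jn].
    by apply: good; exists y.
  apply: xP jn => //; have := lev_tri (g c) x y; have := xg c; lia.
have {bad}/choice[y yP] := bad.
apply: (@not_all_costly l y); last by move=> c; have [] := yP c.
by move=> c c' cc; apply: (gl c c') => //; have [] := yP c; have [] := yP c'.
Qed.

(** For a point cheap at all relevant levels, the costs at successive landing levels satisfy the
    recursion that [bidding] forbids. *)
Lemma spanning_tree_bound N M :
  (forall A : nat -> R, (forall i, (i <= N.+2)%N -> 0 < A i) ->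
    ~ forall i, (i <= N)%N -> A i.+2 <= k * (A i.+1 - A i)) ->
  k <= q ^+ M -> (N.+3 * M + 3 <= n)%N -> False.
Proof.
move=> bid kM nbig.
have [|x [xr xP]] := @ex_cheap 1%N; first lia.
have /choice[i iP] l : exists i, (l < n)%N -> exits x l i.
  case: (ltnP l n) => [ln|_]; last by exists 0%N.
  by have [|i xi] := @exitsE x l; [rewrite xr|exists i].
pose F l := lev x (iter (i l) f x).
pose E l := H x - H (iter (i l) f x).
have FE l : (l < n)%N -> (l < F l)%N by move=> /iP[].
have Fq l : (l < n)%N -> q ^+ F l <= E l.
  move=> ln; have := exit_edge (iP _ ln); have := H_iter x (i l).-1.
  by rewrite /E /F; lra.
have Enext l : (F l < n)%N -> (l < n)%N -> E l + q ^+ F (F l) <= E (F l).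
  move=> Fn ln; have := exit_edge (iP _ Fn).
  (* The path leaves the [F l]-ball strictly after its exit from the [l]-ball, as that exit lands at
     level exactly [F l]. *)
  have ii : (i l <= (i (F l)).-1)%N.
    rewrite leqNgt; apply/negP => ii.
    have [big _] := iP _ Fn; have [_ before] := iP _ ln.
    have : (i (F l) <= i l)%N by lia.
    rewrite leq_eqVlt => /orP[/eqP e|/before]; first by rewrite e ltnn in big.
    have := FE _ ln; lia.
  have := H_iterW x ii; rewrite /E -/(F (F l)); lra.
have cheap l : (0 < l)%N -> (l.+1 < n)%N -> E l < k * q ^+ l.
  move=> l0 ln; rewrite ltNge; apply/negP => El.
  have := xP x l _ l0 ln; rewrite lev_xx; apply=> //.
  by exists (i l); split=> //; apply: iP; exact: ltnW.
pose s j := iter j F 1%N.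
(* By [q^F(s) <= E(s) < k q^s <= q^(s+M)] the level grows by less than [M] per landing, so [n]
   leaves enough room. *)
have sP j : (j <= N.+3)%N -> (0 < s j)%N /\ (s j <= j * M + 1)%N.
  elim: j => [//|j IH] jN; have [s0 sM] := IH (ltnW jN).
  have jM : (j * M <= N.+3 * M)%N by rewrite leq_mul2r (ltnW jN) orbT.
  have sn : ((s j).+1 < n)%N by lia.
  have sF : s j.+1 = F (s j) by [].
  split; first by have := FE (s j) (ltnW sn); rewrite sF; lia.
  have : q ^+ F (s j) < q ^+ (s j + M).
    apply: le_lt_trans (Fq _ (ltnW sn)) _; apply: lt_le_trans (cheap _ s0 sn) _.
    by rewrite exprD mulrC ler_pM2l// exprn_gt0.
  by rewrite ltr_eXn2l// -sF; lia.
have sn j : (j <= N.+2)%N -> (0 < s j)%N /\ ((s j).+1 < n)%N.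
  move=> jN; have [s0 sM] := sP j (leqW jN); split=> //.
  have : (j * M <= N.+3 * M)%N by rewrite leq_mul2r (leqW jN) orbT.
  lia.
apply: (bid (E \o s)) => j jN /=.
  have [s0 sjn] := sn j jN; apply: lt_le_trans (Fq _ (ltnW sjn)).
  by rewrite exprn_gt0.
have [[_ n0] [_ n1] [s2 n2]] :=
  And3 (sn j (leqW (leqW jN))) (sn j.+1 (leqW jN)) (sn j.+2 jN).
apply: le_trans (ltW (cheap _ s2 n2)) _; rewrite ler_pM2l//.
have := Enext (s j) (ltnW n1) (ltnW n0); rewrite -/(s j.+1) -/(s j.+2); lra.
Qed.

End SpanningTreeBound.

(** * The ultrametric space of words *)

Lemma ultrametric_nagata (R : realType) (X : metricType R) :
  (forall y x z : X, mdist x z <= Num.max (mdist x y) (mdist y z)) ->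
  nagata_dim_zero 1 X.
Proof.
move=> ultra s s0.
have far (x y z : X) : mdist x y <= s -> mdist y z <= s -> mdist x z <= s.
  by move=> xy yz; apply: le_trans (ultra y x z) _; rewrite ge_max xy.
pose B (x : X) := [set y | mdist x y <= s].
exists (range B); split.
- rewrite -subTset => x _; exists (B x); first by exists x.
  by rewrite /B /= mdistxx ltW.
- move=> _ [x _ <-]; apply: ge_ereal_sup => _ [b xb [b' xb' <-]].
  by rewrite mul1r lee_fin; apply: far xb'; rewrite metric_sym.
- move=> _ _ [x _ <-] [y _ <-] xy.
  have sxy : s < mdist x y.
    rewrite ltNge; apply/negP => xys; apply: xy; apply/seteqP.
    split=> z; apply: far => //; by rewrite metric_sym.
  (* Points of distinct balls are at least as far apart as the centres, so strictness survives the
     infimum. *)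
  apply: (@lt_le_trans _ _ (mdist x y)%:E); first by rewrite lte_fin.
  apply: le_ereal_inf_tmp => _ [b xb [b' yb' <-]]; rewrite lee_fin leNgt.
  apply/negP => bb'; have := ultra b x y; rewrite leNgt => /negP; apply.
  rewrite gt_max (le_lt_trans xb sxy)/=; apply: le_lt_trans (ultra b' b y) _.
  by rewrite gt_max bb' metric_sym (le_lt_trans yb' sxy).
Qed.

Section Words.
Context {R : realType} (n : nat) (q : R).
Hypothesis q1 : 1 < q.
Implicit Types x y z : {ffun 'I_n -> 'I_9}.

Definition word_level x y : nat := (\max_(i | x i != y i) i.+1)%N.

Lemma word_levelP x y l :
  reflect (forall i : 'I_n, (l <= i)%N -> x i = y i) (word_level x y <= l)%N.
Proof.
rewrite /word_level; apply: (iffP (bigmax_leqP _ _ _)) => H i;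
  last by apply: contraR; rewrite -leqNgt => /H ->.
by move=> li; apply/eqP; apply: contraLR li => /H; rewrite -ltnNge.
Qed.

Lemma word_level_sym x y : word_level x y = word_level y x.
Proof. by apply: eq_bigl => i; rewrite eq_sym. Qed.

Lemma word_level_eq0 x y : (word_level x y == 0%N) = (x == y).
Proof.
rewrite -leqn0; apply/word_levelP/eqP => [xy|-> //].
by apply/ffunP => i; apply: xy.
Qed.

Lemma word_level_tri y x z :
  (word_level x z <= maxn (word_level x y) (word_level y z))%N.
Proof.
apply/word_levelP => i; rewrite geq_max => /andP[xy yz].
by rewrite (word_levelP x y _ xy)// (word_levelP y z _ yz).
Qed.

Lemma word_level_le x y : (word_level x y <= n)%N.
Proof. by apply/word_levelP => i; rewrite leqNgt ltn_ord. Qed.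

Lemma word_level_child x l : (l < n)%N -> exists f : 'I_9 -> {ffun 'I_n -> 'I_9},
  (forall c, word_level x (f c) <= l.+1)%N /\
  forall c c' y y', c != c' -> (word_level (f c) y <= l)%N ->
    (word_level (f c') y' <= l)%N -> word_level y y' = l.+1.
Proof.
move=> ln; exists (fun c => [ffun i : 'I_n => if i == l :> nat then c else x i]); split.
  by move=> c; apply/word_levelP => i li; rewrite ffunE gtn_eqF.
move=> c c' y y' cc /word_levelP cy /word_levelP cy'.
apply/eqP; rewrite eqn_leq; apply/andP; split.
  apply/word_levelP => i li.
  by rewrite -cy ?(ltnW li)// -cy' ?(ltnW li)// !ffunE gtn_eqF.
rewrite ltnNge; apply/negP => /word_levelP/(_ (Ordinal ln) (leqnn _)).
by rewrite -cy// -cy'// !ffunE eqxx => /eqP; rewrite (negPf cc).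
Qed.

Definition word_dist x y : R := if x == y then 0 else q ^+ word_level x y.

Lemma word_dist_ultra y x z :
  word_dist x z <= Num.max (word_dist x y) (word_dist y z).
Proof.
have q0 l : 0 < q ^+ l by rewrite exprn_gt0// (lt_trans _ q1).
rewrite /word_dist; have [->|xy] := eqVneq x y; first by rewrite le_max lexx orbT.
have [<-|yz] := eqVneq y z; first by rewrite (negPf xy) le_max lexx.
have [_|_] := eqVneq x z; first by rewrite le_max ltW.
rewrite le_max !ler_eXn2l//; have := word_level_tri y x z; lia.
Qed.

Lemma word_is_distance : is_distance word_dist.
Proof.
have q0 l : 0 < q ^+ l by rewrite exprn_gt0// (lt_trans _ q1).
have d0 x y : 0 <= word_dist x y.
  by rewrite /word_dist; case: ifP => // _; exact: ltW.
split.
- by move=> x; rewrite /word_dist eqxx.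
- move=> x y; rewrite /word_dist; case: eqP => // _ h.
  by have := q0 (word_level x y); rewrite h ltxx.
- by move=> x y; rewrite /word_dist eq_sym word_level_sym.
- move=> y x z; apply: le_trans (word_dist_ultra y x z) _.
  by rewrite ge_max lerDl lerDr !d0.
Qed.

End Words.

Lemma exists_expr_ge (R : archiRealFieldType) (q k : R) : 1 < q ->
  exists M, k <= q ^+ M.
Proof.
move=> q1; have bernoulli M : 1 + M%:R * (q - 1) <= q ^+ M.
  elim: M => [|M IH]; first by rewrite mul0r addr0 expr0.
  have : q * (1 + M%:R * (q - 1)) <= q * q ^+ M by rewrite ler_wpM2l//; lra.
  have : 0 <= M%:R * (q - 1) * (q - 1) by rewrite !mulr_ge0 ?ler0n//; lra.
  rewrite exprS -natr1; lra.
exists (Num.truncn (k / (q - 1))).+1; apply: le_trans (bernoulli _).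
have : k / (q - 1) < (Num.truncn (k / (q - 1))).+1%:R by exact: truncnS_gt.
rewrite ltr_pdivrMr; lra.
Qed.

Lemma eight_optimal (R : realType) (K : R) : K < 8 ->
  exists X : metricType R, nagata_dim_zero 1 X /\
    ~ (exists D : set X, dense D /\
         exists T : metricType R, is_weighted_tree T /\
           bilipschitz_equivalent K (metric_subspace D) T).
Proof.
(* Replacing [K] by a larger [K0 < 8] leaves room for [q > 1]; the maximum with 1 makes it
   positive. *)
move=> K8; pose K0 : R := Num.max ((K + 8) / 2) 1.
have K0gt : K < K0 by rewrite lt_max; apply/orP; left; lra.
have K08 : K0 < 8 by rewrite gt_max; apply/andP; split; lra.
have K01 : 1 <= K0 by rewrite le_max lexx orbT.
(* [2k] is the midpoint of [K0] and 8, so [k < 4] and [K q < K0 q = 2k]. *)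
pose k := (K0 + 8) / 4; pose q := 2 * k / K0.
have K00 : 0 < K0 by lra.
have q1 : 1 < q by rewrite ltr_pdivlMr// /k; lra.
have k0 : 0 < k by rewrite /k; lra.
have k4 : k < 4 by rewrite /k; lra.
have Kqk : K * q < 2 * k.
  by rewrite /q mulrA ltr_pdivrMr// [K * _]mulrC ltr_pM2l// mulr_gt0.
have [N bid] := bidding k0 k4.
have [M kM] := exists_expr_ge k q1.
pose n := (N.+3 * M + 3)%N.
have dq := @word_is_distance R n q q1.
pose X : metricType R := metrized dq.
exists X; split; first by apply: ultrametric_nagata; exact: word_dist_ultra.
move=> [D [denseD [T [wT [phi [[phi' phiK phi'K] [s [s0 bil]]]]]]]].
have lo (x y : {ffun 'I_n -> 'I_9}) : (0 < word_level x y)%N ->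
    word_dist q x y = q ^+ word_level x y.
  by rewrite lt0n word_level_eq0 /word_dist => /negPf ->.
(* Distinct words are at distance at least 1, so a dense subset is the whole space. *)
have DT (x : X) : D x.
  have [|z [xz Dz]] := denseD (ball x 1)° _ (open_interior _).
    by exists x; apply: nbhsx_ballx.
  move/interior_subset : xz; rewrite ballEmdist /= => xz.
  suff -> : x = z by [].
  apply/eqP; apply: contraTT xz => xz; rewrite -leNgt.
  by rewrite [mdist _ _]/(word_dist _ _ _) /word_dist (negPf xz) exprn_ege1// ltW.
pose h (x : X) : metric_subspace D := SigSub (mem_set (DT x)).
pose g x := phi (h x); pose g' t : X := \val (phi' t).
have gK x : g' (g x) = x by rewrite /g' /g phiK.
have g'K t : g (g' t) = t.
  by rewrite /g /g' -[RHS]phi'K; congr phi; exact: val_inj.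
pose r : X := [ffun=> ord0].
have [f [reach root meet]] := weighted_tree_rooted (g r) wT.
(* The parent map of the tree, carried back to words. *)
pose F x := g' (f (g x)).
have Fg i x : g (iter i F x) = iter i f (g x).
  by elim: i => //= i IH; rewrite /F g'K IH.
have bilg (x y : X) : s * word_dist q x y <= mdist (g x) (g y) <= K * s * word_dist q x y.
  exact: bil (h x) (h y).
(* Dividing by [s] turns the lower bilipschitz factor into 1. *)
pose d (x y : X) := mdist (g x) (g y) / s.
have d_lo (x y : X) : (0 < word_level x y)%N -> q ^+ word_level x y <= d x y.
  by move=> /lo xy; rewrite ler_pdivlMr// -xy mulrC; case/andP: (bilg x y).
have d_up (x y : X) : (0 < word_level x y)%N -> d x y <= K * q ^+ word_level x y.
  by move=> /lo xy; rewrite ler_pdivrMr// -xy mulrAC; case/andP: (bilg x y).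
have d_ge0 x y : 0 <= d x y by rewrite divr_ge0 ?mdist_ge0// ltW.
have d_sym x y : d x y = d y x by rewrite /d metric_sym.
have d_tri y x z : d x z <= d x y + d y z.
  by rewrite -mulrDl ler_pM2r ?invr_gt0// metric_triangle.
have F_reach x : exists i, iter i F x = r.
  by have [i xi] := reach (g x); exists i; rewrite -[LHS]gK Fg xi gK.
have F_root x : d x r = d x (F x) + d (F x) r.
  by rewrite -mulrDl /F g'K -root.
have F_meet x y : exists i j, iter i F x = iter j F y /\
    d x y = d x (iter i F x) + d (iter i F x) y.
  have [i [j [ij xy]]] := meet (g x) (g y); exists i, j; split.
    by rewrite -[LHS]gK Fg ij -Fg gK.
  by rewrite -mulrDl Fg -xy.
have lev_xx (x : X) : word_level x x = 0%N by apply/eqP; rewrite word_level_eq0.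
exact: (spanning_tree_bound lev_xx (@word_level_sym n) (@word_level_tri n)
  (@word_level_le n) (@word_level_child n) q1 k0 K8 Kqk d_lo d_up d_ge0 d_sym
  d_tri F_reach F_root F_meet bid kM (leqnn n)).
Qed.

Theorem theorem1p1 (R : realType) :
  (forall (c : R) (X : metricType R), nagata_dim_zero c X ->
     exists D : set X, dense D /\
       exists T : metricType R, is_weighted_tree T /\
         bilipschitz_equivalent (8 * c) (metric_subspace D) T)
  /\
  (forall K : R, K < 8 ->
     exists X : metricType R, nagata_dim_zero 1 X /\
       ~ (exists D : set X, dense D /\
            exists T : metricType R, is_weighted_tree T /\
              bilipschitz_equivalent K (metric_subspace D) T)).
Proof.
split; first by move=> c X; exact: nagata_weighted_tree.
by move=> K; exact: eight_optimal.
Qed.
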